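(* Let $n$ be a positive integer and let $c,d$ be positive integers with $\gcd(c,d)=1$ and $0<\frac{c}{d}<n$. Let \[\Delta_{\frac{c}{d},n}=\{(x_1,\dots,x_n)\in\mathbb R^n \mid x_1+\cdots+x_n=\tfrac{c}{d},\ 0\le x_i\le 1 \text{ for all } i\},\] so that $d\Delta_{\frac{c}{d},n}=\{x\in\mathbb R^n\mid \sum_i x_i=c,\ 0\le x_i\le d\}$ is a lattice polytope of dimension $n-1$. Then the normalized volume of $d\Delta_{\frac{c}{d},n}$ equals $\left\langle {dn-1 \atop c-1}\right\rangle_d$, i.e. the number of circular permutations of $\{0,1,\dots,dn-1\}$ having exactly $c$ cyclic descents that are fixed under the operation of adding $n$ modulo $dn$ to each entry.
   Context: Normalized volume: for a polytope contained in a hyperplane $\{x\in\mathbb R^n\mid \sum_i x_i=\text{const}\}$, its $(n-1)$-dimensional volume normalized so that the standard simplex $\{x\mid \sum_i x_i=1,\ x_i\ge 0\}$ has volume $1$ (equivalently, $(n-1)!$ times the Euclidean volume measured relative to the lattice $\mathbb Z^n$ intersected with the hyperplane direction). A circular permutation of $\{0,1,\dots,M\}$ is a word $a_0a_1\cdots a_M$ using each element exactly once, considered up to cyclic rotation; its number of cyclic descents is the number of indices $i\in\{0,\dots,M\}$ with $a_i>a_{i+1}$, indices taken modulo $M+1$ (this is invariant under rotation). For $d\mid M+1$, the refined Eulerian number $\left\langle {M \atop k}\right\rangle_d$ is the number of circular permutations of $\{0,\dots,M\}$ with exactly $k+1$ cyclic descents which, as circular permutations, are unchanged when $\frac{M+1}{d}$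 is added modulo $M+1$ to every entry. (For $d=1$ this is the Eulerian number, the number of permutations of $\{1,\dots,M\}$ with $k$ descents.) *)

(* Defs.v *)
From HB Require Import structures.
From mathcomp Require Import all_boot all_order all_algebra all_fingroup.
From mathcomp Require Import all_classical all_reals all_analysis.

Set Implicit Arguments.
Unset Strict Implicit.
Unset Printing Implicit Defensive.

Import Order.TTheory GRing.Theory Num.Theory.

(* A word a_0 a_1 ... a_M using each element of {0, ..., M} exactly once is a
   permutation w : 'S_M.+1 with a_i = w i; recall that (s * w) i = w (s i), so
   that s acts on positions in s * w and on entries in w * s. *)
Section CircularPermutations.
Variable M : nat.
Implicit Types (w : 'S_M.+1) (C : {set 'S_M.+1}).

Definition add_mod (a : nat) : 'S_M.+1 := perm (@addIr 'I_M.+1 (inZp a)).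

Lemma add_modE a i : add_mod a i = (i + a) %% M.+1 :> nat.
Proof. by rewrite permE /= modnDmr. Qed.

(* The class of w is <[add_mod 1]> :* w, i.e. the set of all rotations of w. *)
Definition circular_perms : {set {set 'S_M.+1}} :=
  rcosets <[add_mod 1]>%g [set: 'S_M.+1].

Definition cdes w : nat := #|[set i | (w (add_mod 1 i) < w i)%N]|.

Lemma cdes_rot w r : r \in <[add_mod 1]>%g -> cdes (r * w)%g = cdes w.
Proof.
case/cycleP=> k ->; rewrite /cdes; set r1 := add_mod 1.
have r1C i : r1 ((r1 ^+ k)%g i) = (r1 ^+ k)%g (r1 i).
  by rewrite -!permM -expgSr expgS.
rewrite -[RHS](card_imset _ (@perm_inj _ ((r1 ^+ k)^-1)%g)).
apply: eq_card => i; apply/idP/imsetP => [|[j + ->]]; rewrite !inE !permM.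
  by move=> h; exists ((r1 ^+ k)%g i); rewrite ?permK// inE r1C.
by rewrite -r1C permKV.
Qed.

(* By cdes_rot, all words of a class have the same number of cyclic descents.
   Only meaningful when d divides M.+1. *)
Definition refined_eulerian (k d : nat) : nat :=
  #|[set C in circular_perms |
      [forall w in C, cdes w == k.+1] & (C :* add_mod (M.+1 %/ d))%g == C]|.

End CircularPermutations.

Local Open Scope classical_set_scope.
Local Open Scope ring_scope.

Section LebesgueTuple.
Context {R : realType}.
Local Notation Rm := (measurableTypeR R).

Definition tuple_push m (p : m.-tuple Rm * Rm) : m.+1.-tuple Rm :=
  [tuple of p.2 :: p.1].

Lemma measurable_tuple_push m : measurable_fun setT (@tuple_push m).
Proof. exact: measurable_cons. Qed.

Definition lebesgue_push m (mu : {measure set (m.-tuple Rm) -> \bar R}) :=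
  pushforward (mu \x lebesgue_measure)%E (@tuple_push m).

HB.instance Definition _ m (mu : {measure set (m.-tuple Rm) -> \bar R}) :=
  Measure.copy (lebesgue_push mu)
    (measure_function_pushforward__canonical__measure_function_Measure
       (mu \x lebesgue_measure)%E (@measurable_tuple_push m)).

(* Lebesgue measure on R^m: the m-fold product of the Lebesgue measure on R,
   see lebesgue_tuple_box. *)
Fixpoint lebesgue_tuple m : {measure set (m.-tuple Rm) -> \bar R} :=
  match m with
  | 0 => dirac [tuple]
  | m.+1 => lebesgue_push (lebesgue_tuple m)
  end.

Lemma measurable_tuple_box m (A : 'I_m -> set Rm) :
  (forall i, measurable (A i)) ->
  measurable [set t : m.-tuple Rm | forall i, A i (tnth t i)].
Proof.
move=> mA; rewrite [X in measurable X](_ : _ = \bigcap_(i in setT)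
   (fun i : 'I_m => [set t : m.-tuple Rm | A i (tnth t i)]) i); last first.
  by apply/seteqP; split=> t /= h i => [_|]; exact: h.
apply: fin_bigcap_measurable => [|i _]; first exact: finite_finset.
rewrite -[X in measurable X]setTI.
exact: (@measurable_tnth _ Rm m i measurableT _ (mA i)).
Qed.

Lemma lebesgue_tuple_box m (A : 'I_m -> set Rm) :
  (forall i, measurable (A i)) ->
  lebesgue_tuple m [set t : m.-tuple Rm | forall i, A i (tnth t i)] =
  (\prod_(i < m) lebesgue_measure (A i))%E.
Proof.
elim: m A => [|m IHm] A mA.
  by rewrite big_ord0 /= diracE mem_set// => -[].
rewrite big_ord_recl /= /lebesgue_push /pushforward.
rewrite [X in product_measure1 _ _ X](_ : _ =
   [set t : m.-tuple Rm | forall i, A (lift ord0 i) (tnth t i)] `*` A ord0).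
  rewrite product_measure1E //; last first.
    exact: (@measurable_tuple_box m (fun i => A (lift ord0 i))).
  by rewrite muleC (IHm (fun i => A (lift ord0 i))).
apply/seteqP; split => [[t x] /= h|[t x] /= [ht hx] i].
  by split=> [i|]; [have := h (lift ord0 i); rewrite tnthS|exact: (h ord0)].
by case: (unliftP ord0 i) => [j|] ->; rewrite ?tnthS.
Qed.

End LebesgueTuple.

Section Polytopes.
Variables (R : realType) (n : nat).
Implicit Types P : set 'rV[R]_n.

Definition hypersimplex (s : R) : set 'rV[R]_n :=
  [set x | \sum_i x 0 i = s /\ forall i, 0 <= x 0 i <= 1].

Definition std_simplex : set 'rV[R]_n :=
  [set x | \sum_i x 0 i = 1 /\ forall i, 0 <= x 0 i].

Definition lattice_polytope P : Prop :=
  exists k (V : 'M[int]_(k, n)),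
    P = [set w *m map_mx intr V | w in
          [set w : 'rV[R]_k | \sum_j w 0 j = 1 /\ forall j, 0 <= w 0 j]].

(* The row space of V is the direction of the affine hull of P. *)
Definition has_dim P (k : nat) : Prop :=
  exists p (V : 'M[R]_n),
    [/\ P p, \rank V = k, forall x, P x -> (x - p <= V)%MS
      & forall W : 'M[R]_n, (forall x, P x -> (x - p <= W)%MS) -> (V <= W)%MS].

Definition drop_last (x : 'rV[R]_n) : (n.-1).-tuple R :=
  [tuple x 0 (widen_ord (leq_pred n) i) | i < n.-1].

(* The (n-1)-dimensional volume of a subset P of a hyperplane
   x_1 + ... + x_n = s: on such a hyperplane drop_last is injective and affine,
   and it maps the lattice of integer vectors of coordinate sum 0 onto
   Z^(n-1); hence this is the volume relative to that lattice, which is the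
   Euclidean volume divided by sqrt n. *)
Definition hyperplane_volume P : \bar R :=
  lebesgue_tuple n.-1 (drop_last @` P).

Definition normalized_volume P : \bar R :=
  (hyperplane_volume P / hyperplane_volume std_simplex)%E.

End Polytopes.

(* Main.v *)
Require Import Defs.
From HB Require Import structures.
From mathcomp Require Import all_boot all_order all_algebra all_fingroup.
From mathcomp Require Import cyclic.
From mathcomp Require Import all_classical all_reals all_analysis.
From mathcomp Require Import zify ring lra.

Set Implicit Arguments.
Unset Strict Implicit.
Unset Printing Implicit Defensive.

Import Order.TTheory GRing.Theory Num.Theory.

(* Both sides equal the n-fold backward difference with step d of the truncated
   power s |-> s^(n-1), evaluated at c.

   Volume: projecting away the last coordinate turns the polytope into the slab
   c - d <= t_1 + ... + t_(n-1) <= c of the cube [0, d]^(n-1).  Integrating over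
   a window of length d turns a truncated power into the backward difference of
   the next one, so Fubini gives the volume of {t in [0, d]^m | sum t <= s} as
   an m-fold difference; the slab takes one more.

   Counting: a fixed circular permutation has a unique word w with w_0 = 0.  The
   ascents (w_(i+1) - w_i) mod dn have period n and add up to nc over a period,
   so the partial sums of n consecutive ascents, starting at 0, choose one lift
   r + n q_r in [0, nc) of every residue r modulo n, and w is recovered by
   sorting these lifts.  The only constraint is that consecutive lifts differ by
   less than dn.  Without constraint there are c^(n-1) choices of lifts, and
   lifts with a gap of at least dn after the lift of r correspond, by closing up
   the gap by dn, to lifts for c - d: constraining one more gap is again a
   backward difference with step d. *)

(** * Lifts of the residues modulo n *)

Section Lifts.
Variables n K d : nat.
Implicit Types (q : {ffun 'I_n.+1 -> 'I_K.+1}) (r : 'I_n.+1).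

(** Quotients range up to a fixed [K], so that lifts for [k] and for [k - d] inhabit one finite
    type. *)
Definition lift_val q r : nat := r + n.+1 * q r.

Lemma lift_val_modn q r : lift_val q r %% n.+1 = r.
Proof. by rewrite /lift_val addnC mulnC modnMDl modn_small. Qed.

Lemma lift_val_divn q r : lift_val q r %/ n.+1 = q r.
Proof. by rewrite /lift_val addnC mulnC divnMDl // divn_small ?addn0. Qed.

Lemma lift_val_inj q : injective (lift_val q).
Proof. by move=> r r' e; apply: val_inj; rewrite /= -(lift_val_modn q) e lift_val_modn. Qed.

Definition is_lift k q := [forall r, if r == ord0 then q r == 0 :> nat else q r < k].

(* The end point n.+1 * k counts as a lift: for k = c it is the translate of the
   lift 0 by one period. *)
Definition long_gap k q r :=
  (lift_val q r + d * n.+1 <= n.+1 * k) &&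
  [forall r', (lift_val q r' <= lift_val q r) ||
              (lift_val q r + d * n.+1 <= lift_val q r')].

(** The threshold [t] forbids long gaps one residue at a time, from no constraint at [t = 0] to all
    of them at [t = n.+1]. *)
Definition short_lifts t k :=
  [set q | is_lift k q & [forall r : 'I_n.+1, (r < t) ==> ~~ long_gap k q r]].

Lemma is_lift0 k q : is_lift k q -> q ord0 = 0 :> nat.
Proof. by move/forallP/(_ ord0); rewrite eqxx => /eqP. Qed.

Lemma is_liftS k q r : is_lift k q -> r != ord0 -> q r < k.
Proof. by move=> /forallP/(_ r) /[swap] /negbTE ->. Qed.

(** The quotient at residue 0 is forced; the other [n] range freely over [k] values. *)
Lemma card_short_lifts0 k : k <= K -> #|short_lifts 0 k| = k ^ n.
Proof.
move=> kK.
pose F (r : 'I_n.+1) : pred 'I_K.+1 :=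
  fun j => if r == ord0 then j == 0 :> nat else j < k.
have -> : #|short_lifts 0 k| = #|family F|.
  apply: eq_card => q; rewrite inE; rewrite [X in _ && X](_ : _ = true) ?andbT; last first.
    by apply/forallP.
  by apply/forallP/familyP => h r; exact: h r.
rewrite card_family foldrE big_map enumT -/(index_enum _) /= big_ord_recl /=.
have -> : #|F ord0| = 1.
  rewrite -(card1 (ord0 : 'I_K.+1)); apply: eq_card => j.
  by rewrite inE /F.
rewrite mul1n -[n in RHS]card_ord -prod_nat_const; apply: eq_bigr => i _.
have kK' : k <= K.+1 by lia.
rewrite -[RHS]card_ord -[RHS](fintype.card_image (f := widen_ord kK')); last first.
  by move=> a b /(congr1 val) /= /val_inj.
apply: eq_card => j; rewrite unfold_in /F /=.
apply/idP/fintype.imageP => [jk|[x _ ->]]; last by rewrite /=.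
by exists (Ordinal jk) => //; apply: val_inj.
Qed.

(** [shift_up] and [shift_down] open and close the gap after the lift of [t] by [d * n.+1]; changing
    only quotients keeps the residues. The [inord] is exact where it matters, by [lift_val_up] and
    [lift_val_down]. *)
Definition shift_up (t : 'I_n.+1) q : {ffun 'I_n.+1 -> 'I_K.+1} :=
  [ffun r => if lift_val q t < lift_val q r then inord (q r + d) else q r].

Definition shift_down (t : 'I_n.+1) q : {ffun 'I_n.+1 -> 'I_K.+1} :=
  [ffun r => if lift_val q t < lift_val q r then inord (q r - d) else q r].

Lemma lift_val_up (t : 'I_n.+1) k q r : d <= k -> k <= K -> is_lift (k - d) q ->
  lift_val (shift_up t q) r =
  lift_val q r + (if lift_val q t < lift_val q r then d * n.+1 else 0).
Proof.
move=> dk kK lq; rewrite {1}/lift_val ffunE; case: ifP => tr; last by rewrite addn0.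
rewrite inordK ?mulnDr 1?[d * _]mulnC ?addnA //.
have [r0|r0] := eqVneq r ord0; last by have := is_liftS lq r0; lia.
by move: tr; rewrite r0 /lift_val (is_lift0 lq); nia.
Qed.

(** No truncation occurs: a lift above that of [t] lies beyond the long gap, so its quotient is at
    least [d]. *)
Lemma lift_val_down (t : 'I_n.+1) k q r : is_lift k q -> long_gap k q t ->
  lift_val (shift_down t q) r =
  lift_val q r - (if lift_val q t < lift_val q r then d * n.+1 else 0).
Proof.
move=> lq /andP[_ /forallP/(_ r)].
rewrite [LHS]/lift_val ffunE; case: ifP => tr h; last by rewrite subn0.
have {}h : lift_val q t + d * n.+1 <= lift_val q r by lia.
rewrite inordK; last by have := ltn_ord (q r); lia.
have : d <= q r.
  rewrite -(lift_val_divn q r) -(mulnK d (ltn0Sn n)); apply: leq_div2r.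
  by apply: leq_trans h; rewrite leq_addl.
by rewrite /lift_val; nia.
Qed.

Lemma lift_val_ext q q' : lift_val q =1 lift_val q' -> q = q'.
Proof. by move=> e; apply/ffunP => r; apply: val_inj; rewrite /= -!lift_val_divn e. Qed.

Lemma is_liftE k q : is_lift k q =
  (lift_val q ord0 == 0) && [forall r, (r != ord0) ==> (lift_val q r < n.+1 * k)].
Proof.
apply/idP/idP => [lq|/andP[/eqP q0 /forallP h]].
  apply/andP; split; first by rewrite /lift_val (is_lift0 lq) muln0.
  apply/forallP => r; apply/implyP => r0; have := is_liftS lq r0.
  by rewrite /lift_val; have := ltn_ord r; nia.
apply/forallP => r; case: ifP => [/eqP ->|r0].
  by move: q0; rewrite /lift_val; nia.
by have /implyP/(_ (negbT r0)) := h r; rewrite /lift_val; nia.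
Qed.

Lemma lift_val0 k q : is_lift k q -> lift_val q ord0 = 0.
Proof. by rewrite is_liftE => /andP[/eqP]. Qed.

Lemma lift_val_lt k q r : is_lift k q -> r != ord0 -> lift_val q r < n.+1 * k.
Proof. by rewrite is_liftE => /andP[_ /forallP/(_ r)/implyP]. Qed.

Lemma lift_val_le k q r : is_lift k q -> lift_val q r <= n.+1 * k.
Proof.
move=> lq; have [->|r0] := eqVneq r ord0; first by rewrite (lift_val0 lq).
exact: ltnW (lift_val_lt lq r0).
Qed.

(** Lifts on the same side of the opened gap move together, and the end point moves with the upper
    side, so only the gap after [t] changes length. *)
Lemma shift_upP (t : 'I_n.+1) k q : d <= k -> k <= K ->
  is_lift (k - d) q ->
  [/\ is_lift k (shift_up t q), long_gap k (shift_up t q) t,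
      shift_down t (shift_up t q) = q &
      forall r, r != t ->
        long_gap k (shift_up t q) r = long_gap (k - d) q r].
Proof.
move=> dk kK lq; have E := lift_val_up t _ dk kK lq.
have nkd : n.+1 * (k - d) = n.+1 * k - d * n.+1 by nia.
have nkd' : d * n.+1 <= n.+1 * k by nia.
have tk := lift_val_le t lq.
have lq' : is_lift k (shift_up t q).
  rewrite is_liftE E (lift_val0 lq) /=; apply/forallP => r; apply/implyP => r0.
  by have := lift_val_lt lq r0; rewrite E; case: ifP => ? ?; lia.
have lg : long_gap k (shift_up t q) t.
  rewrite /long_gap; apply/andP; split; first by rewrite E ltnn; lia.
  by apply/forallP => r; rewrite !E ltnn; case: ifP => ?; lia.
split => //.
  apply: lift_val_ext => r; rewrite (lift_val_down _ lq' lg) !E ltnn.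
  by case: (ifP (lift_val q t < lift_val q r)) => h; case: ifP => ?; lia.
move=> r rt.
have rt' : lift_val q r != lift_val q t by apply: contra rt => /eqP/lift_val_inj ->.
have := lift_val_le r lq; have := E r; have := E t; rewrite ltnn addn0 /long_gap.
move: (E); move: (lift_val (shift_up t q)) nkd nkd' tk rt'.
move: (lift_val q) (n.+1 * (k - d)) (n.+1 * k) (d * n.+1) => x a b e y -> eb tk
  xrt Ex Et Er rk; apply/andP/andP => -[h1 /forallP h2]; move/orP: (h2 t) => h2t;
  (split; last (apply/forallP => r'; apply/orP; move: (h2 r') (Ex r') => /orP));
  move: h1 h2t Er; rewrite ?Et; clear - xrt rk eb tk.
- case: (ltnP (x t) (x r)); lia.
- case: (ltnP (x t) (x r)); case: (ltnP (x t) (x r')); lia.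
- case: (ltnP (x t) (x r)); lia.
- case: (ltnP (x t) (x r)); case: (ltnP (x t) (x r')); lia.
Qed.

Lemma shift_downP (t : 'I_n.+1) k q : d <= k -> k <= K ->
  is_lift k q -> long_gap k q t ->
  is_lift (k - d) (shift_down t q) /\ shift_up t (shift_down t q) = q.
Proof.
move=> dk kK lq lg; have E r := lift_val_down r lq lg.
have nkd : n.+1 * (k - d) = n.+1 * k - d * n.+1 by nia.
have nkd' : d * n.+1 <= n.+1 * k by nia.
case/andP: (lg) => h1 /forallP h2.
have lq' : is_lift (k - d) (shift_down t q).
  rewrite is_liftE E (lift_val0 lq) /=; apply/forallP => r; apply/implyP => r0.
  have := lift_val_lt lq r0; rewrite E; case: ifP => h3 h4; first by have := h2 r; lia.
  (* A lift not above that of [t] is at most [n.+1 * (k - d)]; equality would make it a multiple of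
     [n.+1], hence of residue 0. *)
  rewrite subn0 nkd ltn_neqAle; apply/andP; split; last by lia.
  apply: contra r0 => /eqP r0; apply/eqP/val_inj => /=.
  by rewrite -(lift_val_modn q r) r0 -nkd mulnC modnMl.
split=> //; apply: lift_val_ext => r; rewrite (lift_val_up _ _ dk kK lq') !E ltnn.
have [->|rt] := eqVneq r t; first by rewrite !ltnn; lia.
have : lift_val (shift_down t q) r != lift_val (shift_down t q) t.
  by apply: contra rt => /eqP/lift_val_inj ->.
rewrite !E ltnn; have := h2 r.
by case: (ifP (lift_val q t < lift_val q r)) => h; case: ifP => ?; lia.
Qed.

(** Split on whether a long gap follows [t]. If so, closing it is a bijection onto the lifts for
    [k - d], and the constraints on smaller residues are unaffected. *)
Lemma card_short_liftsS t k : t < n.+1 -> k <= K ->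
  #|short_lifts t k| =
  #|short_lifts t.+1 k| + (if d <= k then #|short_lifts t (k - d)| else 0).
Proof.
move=> tn kK; pose T := Ordinal tn.
rewrite -(cardsID [set q | long_gap k q T]) addnC; congr (_ + _).
  apply: eq_card => q; rewrite !inE andbCA; congr (_ && _); apply/andP/forallP.
    move=> [h2 /forallP h1] r; apply/implyP; rewrite ltnS leq_eqVlt => /orP[/eqP e|].
      by rewrite (_ : r = T) //; apply: val_inj.
    by apply/implyP; exact: h1.
  move=> h; split; first by have := h T; rewrite ltnS leqnn.
  by apply/forallP => r; apply/implyP => rt; have /implyP := h r; apply; lia.
(* For [k < d] the end point is too low for any long gap. *)
case: ifP => dk; last first.
  apply/eqP; rewrite cards_eq0; apply/eqP/setP => q; rewrite !inE.
  apply/negP => /andP[_ /andP[h _]]; move: h; nia.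
rewrite -(card_in_imset (f := shift_up T) (D := short_lifts t (k - d))); last first.
  move=> q q'; rewrite !inE => /andP[lq _] /andP[lq' _] e.
  have [_ _ <- _] := shift_upP T dk kK lq.
  by have [_ _ <- _] := shift_upP T dk kK lq'; rewrite e.
apply: eq_card => q; apply/idP/imsetP; last first.
  move=> [q' + ->]; rewrite !inE => /andP[lq' /forallP h].
  have [-> -> _ h'] := shift_upP T dk kK lq'; rewrite andbT /=.
  apply/forallP => r; apply/implyP => rt; rewrite h'; first by have /implyP := h r; apply.
  by apply: contraTneq rt => ->; rewrite ltnn.
rewrite !inE => /andP[/andP[lq /forallP h] lg].
have [lq' eq] := shift_downP dk kK lq lg.
exists (shift_down T q) => //; rewrite inE lq' /=.
apply/forallP => r; apply/implyP => rt.
have [_ _ _ h'] := shift_upP T dk kK lq'.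
rewrite -h' ?eq; first by have /implyP := h r; apply.
by apply: contraTneq rt => ->; rewrite ltnn.
Qed.

End Lifts.

(** * Words of fixed circular permutations *)

Section Words.
Variable M : nat.
Implicit Types (w : 'S_M.+1).

Definition letter w (i : nat) : nat := w (inZp i).

Definition ascent w i : nat := (letter w i.+1 + (M.+1 - letter w i)) %% M.+1.

Definition height w i : nat := \sum_(j < i) ascent w j.

Lemma height0 w : height w 0 = 0. Proof. exact: big_ord0. Qed.

Lemma heightS w i : height w i.+1 = height w i + ascent w i.
Proof. by rewrite /height big_ord_recr. Qed.

Lemma letter_lt w i : letter w i < M.+1. Proof. exact: ltn_ord. Qed.

Lemma inZp_eqP i j : reflect (inZp i = inZp j :> 'I_M.+1) (i == j %[mod M.+1]).
Proof. by apply: (iffP eqP) => [e|/(congr1 val)//]; apply: val_inj. Qed.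

Lemma letter_mod w i j : i = j %[mod M.+1] -> letter w i = letter w j.
Proof. by move/eqP/inZp_eqP; rewrite /letter => ->. Qed.

Lemma letter_inj w i j : letter w i = letter w j -> i = j %[mod M.+1].
Proof. by move/val_inj/perm_inj/inZp_eqP/eqP. Qed.

Lemma letter_val w (i : 'I_M.+1) : letter w i = w i.
Proof. by rewrite /letter valZpK. Qed.

Lemma letter_ext w w' : letter w =1 letter w' -> w = w'.
Proof. by move=> e; apply/permP => i; apply: val_inj; have := e i; rewrite !letter_val. Qed.

Lemma ascent_lt w i : ascent w i < M.+1. Proof. exact: ltn_pmod. Qed.

Lemma letter_ascent w i : letter w i + ascent w i = letter w i.+1 %[mod M.+1].
Proof.
rewrite /ascent modnDmr addnCA subnKC ?modnDr //.
exact: ltnW (letter_lt w i).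
Qed.

Lemma ascentP w i e : e < M.+1 -> letter w i + e = letter w i.+1 %[mod M.+1] ->
  ascent w i = e.
Proof.
move=> eM; rewrite -letter_ascent => /eqP; rewrite eqn_modDl => /eqP.
by rewrite modn_small // modn_small ?ascent_lt.
Qed.

Lemma letter_height w i : letter w 0 + height w i = letter w i %[mod M.+1].
Proof.
elim: i => [|i IH]; first by rewrite height0 addn0.
rewrite heightS addnA -modnDml IH modnDml.
exact: letter_ascent.
Qed.

Lemma ascent_gt0 w i : 0 < M -> 0 < ascent w i.
Proof.
move=> M0; rewrite lt0n; apply/eqP => e; have := letter_ascent w i.
rewrite e addn0 !modn_small ?letter_lt // => /letter_inj/eqP.
by rewrite -(addn1 i) -{1}(addn0 i) eqn_modDl mod0n modn_small.
Qed.

Lemma add_mod_inZp a i : add_mod M a (inZp i) = inZp (i + a).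
Proof. by apply: val_inj; rewrite /= add_modE /= modnDml. Qed.

Lemma add_mod_exp k : (add_mod M 1 ^+ k)%g = add_mod M k.
Proof.
apply/permP => i; rewrite -[i]valZpK add_mod_inZp.
elim: k => [|k IH]; first by rewrite perm1 addn0.
by rewrite expgSr permM IH add_mod_inZp addn1 addnS.
Qed.

(** Each ascent is the difference of two neighbouring letters, plus [M.+1] at a descent; the
    differences cancel around the circle. *)
Lemma height_last w : height w M.+1 = M.+1 * cdes w.
Proof.
have ascE (i : 'I_M.+1) : ascent w i + w i =
    w (add_mod M 1 i) + M.+1 * (w (add_mod M 1 i) < w i).
  have -> : w (add_mod M 1 i) = letter w i.+1 :> nat.
    by rewrite -{1}[i]valZpK add_mod_inZp addn1.
  rewrite -letter_val /ascent; have := letter_lt w i; have := letter_lt w i.+1.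
  move: (letter w i) (letter w i.+1) => a b bM aM; case: ltnP => ab.
    by rewrite modn_small; lia.
  have -> : b + (M.+1 - a) = b - a + M.+1 by lia.
  by rewrite modnDr modn_small; lia.
have e : \sum_(i < M.+1) w i = \sum_(i < M.+1) w (add_mod M 1 i).
  by rewrite (reindex_inj (@perm_inj _ (add_mod M 1))).
have -> : cdes w = \sum_(i < M.+1) (w (add_mod M 1 i) < w i).
  rewrite /cdes -sum1_card [LHS]big_mkcond; apply: eq_bigr => i _; rewrite inE.
  by case: ltnP.
apply: (@addIn (\sum_(i < M.+1) w i)); rewrite [in RHS]e addnC [RHS]addnC big_distrr.
by rewrite addnC /height -!big_split; apply: eq_bigr => i _; exact: ascE.
Qed.

Definition rooted_words c a : {set 'S_M.+1} :=
  [set w : 'S_M.+1 | [&& w ord0 == ord0, cdes w == c &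
               (w * add_mod M a \in <[add_mod M 1]> :* w)%g]].

Lemma fixed_wordP w a :
  reflect (exists k, forall i, letter w (i + k) = letter w i + a %[mod M.+1])
          (w * add_mod M a \in <[add_mod M 1]> :* w)%g.
Proof.
apply: (iffP idP) => [/rcosetP[_ /cycleP[k ->] e]|[k e]].
  exists k => i; have := congr1 (fun s : 'S_M.+1 => nat_of_ord (s (inZp i))) e.
  rewrite !permM add_mod_exp add_mod_inZp -[RHS]/(letter w (i + k)) => <-.
  by rewrite add_modE modn_mod.
apply/rcosetP; exists (add_mod M k); first by rewrite -add_mod_exp mem_cycle.
apply/permP => i; apply: val_inj; rewrite !permM.
have -> : add_mod M k i = inZp (i + k) by rewrite -{1}[i]valZpK add_mod_inZp.
rewrite -[RHS]/(letter w (i + k)) -[RHS](modn_small (letter_lt _ _)) e.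
by rewrite letter_val /= add_modE.
Qed.

(** Each class of rotations contains exactly one word that starts with 0. *)
Lemma refined_eulerianE k d :
  refined_eulerian M k d = #|rooted_words k.+1 (M.+1 %/ d)|.
Proof.
rewrite /refined_eulerian.
set a := add_mod M _; set r := add_mod M 1.
have fixE w : ((<[r]> :* w :* a)%g == (<[r]> :* w)%g) = (w * a \in <[r]> :* w)%g.
  rewrite -rcosetM; apply/eqP/idP => [<-|]; first exact: rcoset_refl.
  by move/rcoset_eqP.
rewrite -(card_in_imset (f := fun w => (<[r]> :* w)%g) (D := rooted_words _ _)).
  apply: eq_card => C; rewrite inE; apply/idP/imsetP; last first.
    move=> [w + ->]; rewrite inE => /and3P[_ /eqP cw fw].
    rewrite fixE fw andbT; apply/andP; split; first by apply/rcosetsP; exists w; rewrite ?inE.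
    by apply/forall_inP => _ /rcosetP[s rs ->]; rewrite cdes_rot // cw.
  case/and3P=> /rcosetsP[w _ ->] /forall_inP cw fw.
  (* Rotation by the position of the letter 0 brings it to the front. *)
  pose v := (r ^+ (w^-1 ord0)%g * w)%g.
  have vw : (v \in <[r]> :* w)%g.
    by apply/rcosetP; exists (r ^+ (w^-1 ord0)%g)%g; rewrite ?mem_cycle.
  exists v; last by apply/rcoset_eqP; rewrite rcoset_sym.
  have e : (<[r]> :* v = <[r]> :* w)%g by apply/rcoset_eqP.
  rewrite inE -fixE e fw cw // !andbT.
  rewrite permM add_mod_exp.
  have -> : add_mod M (w^-1 ord0)%g ord0 = (w^-1)%g ord0.
    by apply: val_inj; rewrite /= add_modE /= add0n modn_small.
  by rewrite permKV.
move=> w w'; rewrite !inE => /and3P[/eqP w0 _ _] /and3P[/eqP w0' _ _] /rcoset_eqP.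
case/rcosetP=> _ /cycleP[j ->] e.
move: w0; rewrite e permM -[in RHS]w0' => /perm_inj.
rewrite /r add_mod_exp => /(congr1 val) /=; rewrite add_modE /= add0n => j0.
rewrite (_ : add_mod M j = 1%g) ?mul1g //; apply/permP => i; apply: val_inj.
by rewrite /= add_modE -modnDmr j0 addn0 modn_small // perm1.
Qed.

End Words.

(** * Sorting the lifts *)

Section Enumeration.
Variables (n K d c : nat).
Implicit Types (q : {ffun 'I_n.+1 -> 'I_K.+1}) (r : 'I_n.+1).

Definition rank q r : nat := #|[set r' | lift_val q r' < lift_val q r]|.

Lemma rank_lt q r : rank q r < n.+1.
Proof.
rewrite -[X in _ < X]card_ord; apply: (@leq_ltn_trans #|[set~ r]|).
  by apply/subset_leq_card/fintype.subsetP => r';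
    rewrite !inE; apply: contraTneq => ->; rewrite ltnn.
by rewrite cardsC1 card_ord.
Qed.

Lemma rank_mono q : {mono rank q : r r' / lift_val q r < lift_val q r' >-> r < r'}.
Proof.
suff lt r r' : lift_val q r < lift_val q r' -> rank q r < rank q r'.
  move=> r r'; case: (ltngtP (lift_val q r) (lift_val q r')) => h.
  - exact: lt.
  - by apply/negbTE; rewrite -leqNgt ltnW // lt.
  - by rewrite /rank h ltnn.
move=> rr'; apply: proper_card; apply/properP; split.
  by apply/fintype.subsetP => s; rewrite !inE => /ltn_trans; apply.
by exists r; rewrite !inE ?ltnn.
Qed.

Definition ord_rank q r : 'I_n.+1 := Ordinal (rank_lt q r).

Lemma ord_rank_inj q : injective (ord_rank q).
Proof.
move=> r r' /(congr1 val) /= e; apply: (@lift_val_inj _ _ q).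
by have := rank_mono q r r'; have := rank_mono q r' r; rewrite e ltnn; case: ltngtP.
Qed.

Definition rank_perm q : 'S_n.+1 := perm (@ord_rank_inj q).

(* The increasing enumeration of the lifts and of their translates by multiples
   of n.+1 * c. *)
Definition enum_lift q i : nat :=
  lift_val q ((rank_perm q)^-1%g (inZp i)) + n.+1 * c * (i %/ n.+1).

Lemma enum_lift_rank q r : enum_lift q (rank q r) = lift_val q r.
Proof.
rewrite /enum_lift divn_small ?rank_lt // muln0 addn0; congr lift_val.
rewrite (_ : inZp _ = rank_perm q r) ?permK // permE.
by apply: val_inj; rewrite /= modn_small ?rank_lt.
Qed.

Lemma enum_lift_periodic q i : enum_lift q (i + n.+1) = enum_lift q i + n.+1 * c.
Proof.
rewrite /enum_lift divnDr ?dvdnn // divnn /= mulnDr muln1 addnA; congr (lift_val _ _ + _ + _).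
by congr ((rank_perm q)^-1%g _); apply: val_inj; rewrite /= modnDr.
Qed.

Lemma enum_lift_periodicM q i j : enum_lift q (i + n.+1 * j) = enum_lift q i + n.+1 * c * j.
Proof.
elim: j => [|j IH]; first by rewrite !muln0 !addn0.
by rewrite mulnS addnCA addnC enum_lift_periodic IH -addnA -mulnSr.
Qed.

Lemma enum_lift_small q i (ni : i < n.+1) :
  exists2 r, enum_lift q i = lift_val q r & i = rank q r.
Proof.
pose r := (rank_perm q)^-1%g (Ordinal ni).
have ir : rank q r = i.
  by have := congr1 val (permKV (rank_perm q) (Ordinal ni)); rewrite /= permE.
by exists r; rewrite -?enum_lift_rank ir.
Qed.

Lemma rank0 q : is_lift c q -> rank q ord0 = 0.
Proof.
move=> lq; apply/eqP; rewrite cards_eq0; apply/eqP/setP => r.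
by rewrite !inE (lift_val0 lq).
Qed.

Lemma enum_lift0 q : is_lift c q -> enum_lift q 0 = 0.
Proof. by move=> lq; have := enum_lift_rank q ord0; rewrite (rank0 lq) (lift_val0 lq). Qed.

(** The successor of a lift in sorted order is the next lift, or the end point after the last one; a
    jump of [d * n.+1] or more would be a long gap. *)
Lemma enum_lift_step q i : 0 < c -> is_lift c q -> (forall r, ~~ long_gap d c q r) ->
  enum_lift q i < enum_lift q i.+1 < enum_lift q i + d * n.+1.
Proof.
move=> c0 lq sg.
suff H j : j < n.+1 -> enum_lift q j < enum_lift q j.+1 < enum_lift q j + d * n.+1.
  rewrite (divn_eq i n.+1) mulnC addnC -addSn !enum_lift_periodicM.
  have := H (i %% n.+1) (ltn_pmod i (ltn0Sn n)); lia.
move=> jn; have [r -> jr] := enum_lift_small q jn.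
have := sg r; rewrite negb_and negb_forall -ltnNge.
have [j1n|] := ltnP j.+1 n.+1.
  have [r' -> jr'] := enum_lift_small q j1n.
  have rr' : lift_val q r < lift_val q r' by rewrite -rank_mono -jr -jr'.
  (* Either the end point is too close for a long gap, and it bounds the next lift, or some lift [s]
     lies in the gap, no earlier than the next lift. *)
  rewrite rr'; case/orP=> [h|/existsP[s]].
    by apply: leq_trans h; have := lift_val_le r' lq; lia.
  rewrite negb_or -!ltnNge => /andP[rs]; apply: leq_ltn_trans.
  by rewrite leqNgt -rank_mono -leqNgt -jr' jr rank_mono.
(* After the last lift comes the translate of 0, and no lift [s] exceeds the last. *)
move=> nj; have jn' : j = n by lia.
have rn : lift_val q r < n.+1 * c.
  have [->|] := eqVneq r ord0; last exact: lift_val_lt.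
  by rewrite (lift_val0 lq) muln_gt0.
have e1 := enum_lift_periodic q 0; rewrite add0n (enum_lift0 lq) add0n in e1.
rewrite jn' e1 rn.
case/orP=> // /existsP[s]; rewrite negb_or -ltnNge => /andP[].
by rewrite -rank_mono -jr jn' ltnNge -ltnS rank_lt.
Qed.

End Enumeration.

(** * Bijection between short lifts and rooted words *)

Section Correspondence.
Variables (M n K d c : nat).
Hypothesis MnE : M.+1 = d * n.+1.
Hypotheses (c_gt0 : 0 < c) (cd : coprime c d) (cK : c <= K).
Implicit Types (q : {ffun 'I_n.+1 -> 'I_K.+1}) (w : 'S_M.+1).

Lemma d_gt0 : 0 < d. Proof. by have := MnE; case: d. Qed.

Lemma short_liftsP q : reflect (is_lift c q /\ forall r, ~~ long_gap d c q r)
  (q \in short_lifts n K d n.+1 c).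
Proof.
rewrite inE; apply: (iffP andP) => -[-> h]; split=> //.
  by move=> r; move/forallP/(_ r): h; rewrite ltn_ord.
by apply/forallP => r; rewrite h implybT.
Qed.

Lemma coprime_modn_inv u : coprime u d -> exists j, u * j = 1 %[mod d].
Proof.
move=> ud; exists (u ^ (totient d).-1).
by rewrite -expnS prednK ?totient_gt0 ?d_gt0 // Euler_exp_totient.
Qed.

Lemma modn_cancel x y : c * x = c * y %[mod d] -> x = y %[mod d].
Proof.
have [v cv] := coprime_modn_inv cd.
have vE z : v * (c * z) = z %[mod d] by rewrite mulnA [v * c]mulnC -modnMml cv modnMml mul1n.
by move=> e; rewrite -vE -modnMmr e modnMmr vE.
Qed.

Lemma modn_scale x y : n.+1 * x = n.+1 * y %[mod M.+1] <-> x = y %[mod d].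
Proof.
rewrite MnE [d * _]mulnC -!muln_modr; split=> [/eqP|->//].
by rewrite eqn_pmul2l // => /eqP.
Qed.

(** Modulo [n.+1] the value determines the residue, hence [i] modulo [n.+1]. What remains is a
    multiple of [n.+1 * c], where coprimality cancels [c] modulo [d]. *)
Lemma enum_lift_inj q i j : is_lift c q ->
  enum_lift c q i = enum_lift c q j %[mod M.+1] -> i = j %[mod M.+1].
Proof.
move=> lq e.
have : enum_lift c q i = enum_lift c q j %[mod n.+1].
  by have := congr1 (modn^~ n.+1) e; rewrite /= !modn_dvdm // MnE dvdn_mull.
rewrite /enum_lift -!mulnA ![n.+1 * _]mulnC ![lift_val _ _ + _]addnC !modnMDl !lift_val_modn.
move/val_inj/perm_inj/(congr1 val) => /= ij.
have E k : k = k %% n.+1 + n.+1 * (k %/ n.+1) by rewrite addnC mulnC -divn_eq.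
move: e; rewrite (E i) (E j) ij !enum_lift_periodicM -!mulnA => /eqP.
rewrite eqn_modDl => /eqP/modn_scale/modn_cancel/modn_scale e.
by apply/eqP; rewrite eqn_modDl; apply/eqP.
Qed.

Lemma enum_lift_modn q i : enum_lift c q (i %% M.+1) = enum_lift c q i %[mod M.+1].
Proof.
have {2}-> : i = i %% M.+1 + n.+1 * (d * (i %/ M.+1)).
  by rewrite {1}(divn_eq i M.+1) addnC mulnA [n.+1 * d]mulnC -MnE mulnC.
rewrite enum_lift_periodicM (_ : _ * c * _ = c * (i %/ M.+1) * M.+1); last by rewrite MnE; lia.
by rewrite addnC modnMDl.
Qed.

(** The enumeration is shown to be a permutation under [is_lift] only, hence the [pick]; for such
    [q] the default is never reached, by [letter_lift_word]. *)
Definition lift_word q : 'S_M.+1 :=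
  odflt 1%g [pick w : 'S_M.+1 | [forall i, w i == inZp (enum_lift c q i)]].

Lemma letter_lift_word q i : is_lift c q ->
  letter (lift_word q) i = enum_lift c q i %% M.+1.
Proof.
move=> lq.
have inj : injective (fun i : 'I_M.+1 => inZp (enum_lift c q i) : 'I_M.+1).
  move=> j k /(congr1 val) /= /(enum_lift_inj lq).
  by rewrite !modn_small ?ltn_ord // => /val_inj.
rewrite /lift_word; case: pickP => [w /forallP h|/(_ (perm inj))/forallP[]].
  by rewrite /letter (eqP (h _)) /= enum_lift_modn.
by move=> j; rewrite permE.
Qed.

(** Without long gaps the steps of the enumeration stay below [M.+1], so they equal the ascents
    instead of being merely congruent to them. *)
Lemma height_lift_word q i : q \in short_lifts n K d n.+1 c ->
  height (lift_word q) i = enum_lift c q i.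
Proof.
case/short_liftsP => lq sg.
have asc j : ascent (lift_word q) j = enum_lift c q j.+1 - enum_lift c q j.
  have /andP[h1 h2] := enum_lift_step j c_gt0 lq sg.
  apply: ascentP; first by rewrite MnE; lia.
  by rewrite !letter_lift_word // modnDml modn_mod subnKC // ltnW.
elim: i => [|i IH]; first by rewrite height0 enum_lift0.
rewrite heightS IH asc subnKC //.
by have /andP[/ltnW] := enum_lift_step i c_gt0 lq sg.
Qed.

Lemma lift_word_rooted q : q \in short_lifts n K d n.+1 c ->
  lift_word q \in rooted_words M c n.+1.
Proof.
move=> qs; have /short_liftsP[lq sg] := qs; rewrite inE; apply/and3P; split.
- apply/eqP/val_inj; rewrite -[LHS]letter_val letter_lift_word //.
  by rewrite (enum_lift0 lq) mod0n.
(* After [d] periods the height is [n.+1 * c * d = M.+1 * c], which means [c] descents. *)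
- have := height_last (lift_word q); rewrite height_lift_word // {1}MnE.
  have := enum_lift_periodicM c q 0 d; rewrite add0n mulnC (enum_lift0 lq) add0n => ->.
  by rewrite mulnAC [_ * d]mulnC -MnE => /eqP; rewrite eqn_pmul2l // eq_sym.
(* With [v] inverse to [c] modulo [d], rotation by [n.+1 * v] adds [n.+1 * c * v], which is
   congruent to [n.+1]. *)
- apply/fixed_wordP; have [v cv] := coprime_modn_inv cd.
  exists (n.+1 * v) => i; rewrite !letter_lift_word // enum_lift_periodicM.
  rewrite modn_mod modnDml; apply/eqP; rewrite eqn_modDl -mulnA.
  by rewrite -[X in _ == X %[mod _]]muln1 MnE [d * _]mulnC -!muln_modr cv.
Qed.

Lemma lift_word_inj : {in short_lifts n K d n.+1 c &, injective lift_word}.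
Proof.
move=> q q' qs qs' e; apply: lift_val_ext => r.
have E : enum_lift c q =1 enum_lift c q'.
  by move=> i; rewrite -!height_lift_word // e.
have := E (rank q r); rewrite enum_lift_rank.
have [r' -> _] := enum_lift_small c q' (rank_lt q r).
move=> h; rewrite h; congr lift_val; apply: val_inj.
by rewrite /= -(lift_val_modn q r) h lift_val_modn.
Qed.

(** The heights over one period serve as the lifts, once the ascents are known to have period [n.+1]
    and the heights to meet each residue once. *)
Lemma rooted_word_lift w : w \in rooted_words M c n.+1 ->
  exists2 q, q \in short_lifts n K d n.+1 c & w = lift_word q.
Proof.
rewrite inE => /and3P[/eqP w0 /eqP cw /fixed_wordP[k wk]].
have d0 := d_gt0.
(* A one-letter word has no descent, whereas [c] is positive. *)
have M0 : 0 < M.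
  rewrite lt0n; apply/eqP => M0; have := cw; rewrite /cdes.
  move: w {w0 cw wk}; rewrite M0 => w.
  rewrite eq_card0 => [e|i]; first by have := c_gt0; rewrite -e.
  by rewrite !inE (ord1 (add_mod 0 1 i)) (ord1 i) ltnn.
have wkj j i : letter w (i + k * j) = letter w i + n.+1 * j %[mod M.+1].
  elim: j => [|j IH]; first by rewrite !muln0 !addn0.
  by rewrite [k * _]mulnSr [n.+1 * _]mulnSr (addnA i) wk -modnDml IH modnDml addnA.
(* Rotating [d] times by [k] adds [d * n.+1 = M.+1], that is nothing, so [M.+1] divides [k * d]. *)
have nk : n.+1 %| k.
  have := wkj d 0; rewrite [n.+1 * d]mulnC -MnE modnDr !modn_small ?letter_lt //.
  move/letter_inj; rewrite add0n mod0n => /eqP; rewrite -/(_ %| _) MnE [k * d]mulnC.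
  by rewrite dvdn_pmul2l.
case/dvdnP: nk => u ku.
(* With [g = gcdn u d], rotation by [k * (d / g)] is trivial yet adds [n.+1 * (d / g)], so [d]
   divides [d / g]. *)
have ud : coprime u d.
  have dE : gcdn u d * (d %/ gcdn u d) = d by rewrite mulnC divnK ?dvdn_gcdr.
  have := wkj (d %/ gcdn u d) 0; rewrite add0n.
  rewrite (_ : k * _ = u %/ gcdn u d * M.+1); last first.
    transitivity (u %/ gcdn u d * (gcdn u d * (d %/ gcdn u d) * n.+1)); last by rewrite dE MnE.
    by rewrite ku -{1}(divnK (dvdn_gcdl u d)); lia.
  rewrite (@letter_mod _ _ _ 0); last by rewrite modnMl mod0n.
  move/eqP; rewrite -{1}[letter w 0]addn0 eqn_modDl -{1}(muln0 n.+1) => /eqP/modn_scale.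
  rewrite mod0n => /esym/eqP; rewrite -/(_ %| _) -{1}dE -{2}[_ %/ _]mul1n.
  rewrite dvdn_pmul2r ?dvdn1 // divn_gt0 ?gcdn_gt0 ?d0 ?orbT //.
  by rewrite dvdn_leq ?dvdn_gcdr.
have letter0 : letter w 0 = 0 by rewrite -[0]/(val (@ord0 M)) letter_val w0.
have letterE i : letter w i = height w i %[mod M.+1].
  by rewrite -letter_height letter0.
have [v uv] := coprime_modn_inv ud.
(* Rotating [v] times by [k = u * n.+1] amounts to rotating by [n.+1], as [u * v] is 1 modulo
   [d]. *)
have letter_per i : letter w (i + n.+1) = letter w i + n.+1 * v %[mod M.+1].
  rewrite -wkj; congr (_ %% _); apply: letter_mod; apply/eqP; rewrite eqn_modDl.
  rewrite ku mulnAC mulnC -[X in X == _ %[mod _]]muln1; apply/eqP/modn_scale.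
  by rewrite uv.
have asc_per i : ascent w (i + n.+1) = ascent w i.
  apply: ascentP; first exact: ascent_lt.
  by rewrite -modnDml letter_per modnDml addnAC -modnDml letter_ascent modnDml -addSn letter_per.
have height_add i : height w (i + n.+1) = height w i + height w n.+1.
  elim: i => [|i IH]; first by rewrite height0.
  by rewrite addSn (heightS _ (i + _)) IH asc_per (heightS _ i) addnAC.
(* The total height [M.+1 * c] splits into [d] equal periods. *)
have height_n : height w n.+1 = n.+1 * c.
  have heightM j : height w (n.+1 * j) = j * height w n.+1.
    elim: j => [|j IH]; first by rewrite muln0 height0.
    by rewrite mulnSr height_add IH mulSn addnC.
  have := heightM d; rewrite mulnC -MnE height_last cw MnE -mulnA => /eqP.
  by rewrite eqn_pmul2l // => /eqP.
have height_per i : height w (i + n.+1) = height w i + n.+1 * c.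
  by rewrite height_add height_n.
have height_perM i j : height w (i + n.+1 * j) = height w i + n.+1 * c * j.
  elim: j => [|j IH]; first by rewrite !muln0 !addn0.
  by rewrite mulnS addnCA addnC height_per IH -addnA -mulnSr.
have height_lt i j : i < j -> height w i < height w j.
  elim: j => // j IH; rewrite ltnS leq_eqVlt => ij.
  apply: (@leq_ltn_trans (height w j)).
    by case/orP: ij => [/eqP-> //|/IH/ltnW].
  by rewrite heightS -addn1 leq_add2l ascent_gt0.
have height_ltE i j : (height w i < height w j) = (i < j).
  case: (ltngtP i j) => [/height_lt ->//|/height_lt/ltnW|->]; last by rewrite ltnn.
  by rewrite leqNgt => /negbTE.
have height_step i : height w i.+1 < height w i + d * n.+1.
  by rewrite heightS ltn_add2l -MnE ascent_lt.
(* Letters congruent modulo [n.+1] are carried to each other by rotations by multiples of [k], hence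
   of [n.+1]; so their positions agree modulo [n.+1]. *)
have inj : injective (fun i : 'I_n.+1 => inZp (height w i) : 'I_n.+1).
  move=> i j /(congr1 val) /= ij; apply: val_inj => /=.
  have : letter w i = letter w j %[mod n.+1].
    have nM : n.+1 %| M.+1 by rewrite MnE dvdn_mull.
    by rewrite -(modn_dvdm _ nM) letterE modn_dvdm // ij
      -[in LHS](modn_dvdm _ nM) -letterE modn_dvdm.
  move=> lij; pose a := letter w i %/ n.+1; pose b := letter w j %/ n.+1.
  (* The number [b + (d * a - a)] stands for [b - a] modulo [d]. *)
  have : letter w (i + k * (b + (d * a - a))) = letter w j %[mod M.+1].
    rewrite wkj [in LHS](divn_eq (letter w i) n.+1) [in RHS](divn_eq (letter w j) n.+1).
    rewrite lij -/a -/b.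
    have -> : a * n.+1 + letter w j %% n.+1 + n.+1 * (b + (d * a - a)) =
              a * M.+1 + (b * n.+1 + letter w j %% n.+1).
      have : n.+1 * a <= n.+1 * (d * a) by rewrite leq_pmul2l // leq_pmull.
      move=> /subnKC e; rewrite mulnDr mulnBr [n.+1 * b + _]addnC addnACA [a * n.+1]mulnC e.
      by rewrite MnE [n.+1 * b]mulnC [n.+1 * _]mulnC mulnAC mulnC [_ %% _ + _]addnC.
    by rewrite modnMDl.
  rewrite !modn_small ?letter_lt // => /letter_inj/(congr1 (modn^~ n.+1)) /=.
  by rewrite !modn_dvdm ?MnE ?dvdn_mull // ku mulnAC addnC modnMDl !modn_small.
pose s := perm inj.
have sE i : s i = height w i %% n.+1 :> nat by rewrite permE.
have hlt (i : 'I_n.+1) : height w i < n.+1 * c by rewrite -height_n height_lt.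
(* The lift of [r] is the height at the one position of the period where the height has residue
   [r]. *)
pose q : {ffun 'I_n.+1 -> 'I_K.+1} := [ffun r => inord (height w (s^-1%g r) %/ n.+1)].
have liftE r : lift_val q r = height w (s^-1%g r).
  rewrite /lift_val ffunE inordK; last first.
    by rewrite ltnS; apply: leq_trans cK; rewrite ltnW // ltn_divLR // mulnC hlt.
  have := sE (s^-1%g r); rewrite permKV => {1}->.
  by rewrite addnC mulnC -divn_eq.
have liftsE i : lift_val q (s i) = height w i by rewrite liftE permK.
have rankE r : rank q r = s^-1%g r.
  rewrite /rank (_ : [set _ | _] = s @: [set i : 'I_n.+1 | i < s^-1%g r]).
    rewrite card_imset; last exact: perm_inj.
    by rewrite -sum1dep_card big_ord_narrow ?sum1_card ?card_ord // ltnW.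
  apply/setP => r'; rewrite inE !liftE height_ltE; apply/idP/imsetP => [h|[i + ->]].
    by exists (s^-1%g r'); rewrite ?inE ?permKV.
  by rewrite inE permK.
have enumE i : enum_lift c q i = height w i.
  rewrite (divn_eq i n.+1) addnC mulnC enum_lift_periodicM height_perM; congr (_ + _).
  pose r := s (inZp i); have -> : i %% n.+1 = rank q r by rewrite rankE permK.
  by rewrite enum_lift_rank liftE -rankE.
have lq : is_lift c q.
  rewrite is_liftE; apply/andP; split; last first.
    by apply/forallP => r; apply/implyP => _; rewrite liftE.
  have -> : ord0 = s ord0 by apply: val_inj; rewrite /= sE height0 mod0n.
  by rewrite liftsE height0.
exists q; last first.
  apply: letter_ext => i; rewrite letter_lift_word ?lq // enumE -letterE.
  by rewrite modn_small ?letter_lt.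
apply/short_liftsP; split=> //.
move=> r; rewrite negb_and negb_forall -ltnNge; pose i := s^-1%g r.
(* The next height is a lift inside the gap; at the last position the end point takes its place. *)
have [i1n|ni] := ltnP i.+1 n.+1.
  apply/orP; right; apply/existsP; exists (s (Ordinal i1n)).
  by rewrite liftsE liftE negb_or -!ltnNge height_ltE ltnSn height_step.
have ein : i = n :> nat by apply/eqP; rewrite eqn_leq -ltnS ltn_ord -ltnS ni.
by apply/orP; left; rewrite liftE -height_n; have := height_step i; rewrite {1}ein.
Qed.

Lemma card_rooted_words :
  #|rooted_words M c n.+1| = #|short_lifts n K d n.+1 c|.
Proof.
rewrite -(card_in_imset lift_word_inj); apply: eq_card => w.
apply/idP/imsetP => [/rooted_word_lift[q qs ->]|[q qs ->]]; first by exists q.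
exact: lift_word_rooted.
Qed.

End Correspondence.

Import numFieldNormedType.Exports.
Local Open Scope classical_set_scope.
Local Open Scope ring_scope.

(** * Volume of the polytope *)

Section Volume.
Context {R : realType}.
Local Notation Rm := (measurableTypeR R).
Local Notation mu := (@lebesgue_measure R).

Lemma lebesgue_tuple_sigma_finite m : sigma_finite setT (@lebesgue_tuple R m).
Proof.
pose A k : set (m.-tuple Rm) :=
  [set t : m.-tuple Rm | forall i : 'I_m, `[- k%:R, k%:R]%classic (tnth t i)].
exists A => [|k].
  apply/esym; rewrite -subTset => t _.
  pose B := \big[Num.max/0]_(i < m) `|tnth t i|.
  exists (Num.bound B) => // i; rewrite /= in_itv /= -ler_norml.
  have h : `|tnth t i| <= B by exact: le_bigmax.
  by apply: le_trans h (ltW (archi_boundP _)); exact: bigmax_ge_id.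
have mA (i : 'I_m) : measurable (`[- k%:R, k%:R]%classic : set Rm) by [].
split; first exact: (@measurable_tuple_box R m (fun=> `[- k%:R, k%:R]%classic)).
rewrite /A (@lebesgue_tuple_box R m (fun=> `[- k%:R, k%:R]%classic)) //.
rewrite (eq_bigr (fun=> (k%:R *+ 2)%:E)) => [|i _]; last first.
  rewrite lebesgue_measure_itv /= lte_fin; case: ifPn => [_|].
    by rewrite -EFinB opprK mulr2n.
  rewrite -leNgt => kk; have := ler0n R k => k0.
  have -> : k%:R = 0 :> R by lra.
  by rewrite mul0rn.
by rewrite prodEFin ltry.
Qed.

(* HB instances need a function symbol as their key. *)
Definition lebesgue_tuple_mu m : set (m.-tuple Rm) -> \bar R := lebesgue_tuple m.

HB.instance Definition _ m := Measure.copy (@lebesgue_tuple_mu m) (@lebesgue_tuple R m).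

HB.instance Definition _ m := Measure_isSigmaFinite.Build _ _ _
  (@lebesgue_tuple_mu m) (@lebesgue_tuple_sigma_finite m).

(** The definition takes sections at a fixed [m]-tuple; uniqueness of the product of sigma-finite
    measures allows slicing at a fixed pushed coordinate instead. *)
Lemma lebesgue_tupleS m (A : set (m.+1.-tuple Rm)) : measurable A ->
  lebesgue_tuple m.+1 A =
  (\int[mu]_x lebesgue_tuple m [set t : m.-tuple Rm | A (tuple_push (t, x))])%E.
Proof.
move=> mA; pose m1 : {sigma_finite_measure set (m.-tuple Rm) -> \bar R} :=
  @lebesgue_tuple_mu m.
have mA' : measurable (@tuple_push R m @^-1` A).
  by rewrite -[X in measurable X]setTI; exact: measurable_tuple_push.
have -> : lebesgue_tuple m.+1 A = (m1 \x mu)%E (@tuple_push R m @^-1` A) by [].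
rewrite (@product_measure_unique _ _ _ _ _ m1 mu (m1 \x^ mu)%E) //; last first.
  by move=> *; exact: product_measure2E.
apply: eq_integral => x _; congr (lebesgue_tuple m _).
by apply/seteqP; split=> t; rewrite /ysection /= inE.
Qed.

End Volume.

(** * Truncated powers, backward differences and slices of a cube *)

Section TruncatedPowers.
Context {R : realType}.
Local Notation Rm := (measurableTypeR R).
Local Notation mu := (@lebesgue_measure R).
Implicit Types (s x e d : R) (f g : R -> R).

(** For [m = 0] this is the indicator of the closed half-line, as [0 ^+ 0] is 1. *)
Definition tpow m s : R := if 0 <= s then s ^+ m else 0.

Definition bdiff d f s := f s - f (s - d).

Lemma continuous_subX s m : continuous (fun x : R => (s - x) ^+ m).
Proof.
move=> x; apply: (@continuous_comp _ _ _ (fun x : R => s - x) (fun y => y ^+ m)).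
  by apply: cvgB; [exact: cvg_cst|exact: cvg_id].
exact: exprn_continuous.
Qed.

Lemma integrable_subX s m e : mu.-integrable `[0, e] (EFin \o (fun x => (s - x) ^+ m)).
Proof.
apply: continuous_compact_integrable; first exact: segment_compact.
by apply: continuous_subspaceT; exact: continuous_subX.
Qed.

Lemma integral_subX s m e : 0 <= e ->
  (\int[mu]_(x in `[0%R, e]) ((s - x) ^+ m)%:E =
   ((s ^+ m.+1 - (s - e) ^+ m.+1) / m.+1%:R)%:E)%E.
Proof.
rewrite le_eqVlt => /predU1P[<-|e0].
  by rewrite set_itv1 integral_set1 subr0 subrr mul0r.
pose F x := - (s - x) ^+ m.+1 / m.+1%:R.
have dF x : is_derive x 1 F ((s - x) ^+ m).
  have -> : F = (- m.+1%:R^-1) \*: ((cst s - id) ^+ m.+1).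
    by apply/funext => y; rewrite /F !fctE /= mulNr mulrC -mulNr.
  apply: is_derive_eq; rewrite !fctE /= sub0r /GRing.scale /=.
  by field; rewrite addrC natr1 pnatr_eq0.
have cF : continuous F.
  by move=> x; apply/differentiable_continuous/derivable1_diffP; case: (dF x).
rewrite (@continuous_FTC2 _ (fun x => (s - x) ^+ m) F) //.
- by rewrite /F subr0 -EFinB; congr EFin; ring.
- by apply: continuous_subspaceT; exact: continuous_subX.
- split=> [x _||]; first by case: (dF x).
    by apply: cvg_at_right_filter; exact: cF.
  by apply: cvg_at_left_filter; exact: cF.
- by move=> x _; rewrite derive1E; have [_ ->] := dF x.
Qed.

(** [g] acts as an antiderivative of [f] over windows of length [d]; integrability is carried along
    so that linearity applies. *)
Definition window_integral d f g := forall s,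
  mu.-integrable `[0, d] (fun x => (f (s - x))%:E) /\
  (\int[mu]_(x in `[0%R, d]) (f (s - x))%:E = (bdiff d g s)%:E)%E.

(** Truncation cuts the window down to [[0, min d s]], where the integrand is a polynomial. *)
Lemma window_tpow d m : 0 < d ->
  window_integral d (tpow m) (fun s => tpow m.+1 s / m.+1%:R).
Proof.
move=> d0 s; pose h x := (s - x) ^+ m.
have E x : x \in `[0%R, d]%classic ->
    (tpow m (s - x))%:E = ((EFin \o h) \_ `[0%R, s]) x.
  rewrite inE /= in_itv /= => /andP[x0 xd]; rewrite /tpow subr_ge0 patchE /=.
  by rewrite mem_setE in_itv /= x0 /=; case: ifP.
have IE : `[0%R, d]%classic `&` `[0%R, s]%classic = `[0%R, Num.min d s]%classic.
  apply/seteqP; split => x; rewrite /= !in_itv /= le_min.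
    by move=> [/andP[-> ->] /andP[_ ->]].
  by move=> /and3P[-> -> ->].
split.
  apply: (@eq_integrable _ _ _ mu _ _ ((EFin \o h) \_ `[0, s])) => //; first by move=> x /E.
  apply/integrable_mkcond; rewrite // -patch_setI IE.
  apply/(@integrable_mkcond _ _ _ mu `[0, Num.min d s]%classic) => //.
  exact: integrable_subX.
transitivity (\int[mu]_(x in `[0%R, d]) ((EFin \o h) \_ `[0%R, s]) x)%E.
  by apply: eq_integral => x /E.
rewrite -integral_mkcondr IE.
have [s0|s0] := ltP s 0.
  rewrite set_itv_ge ?integral_set0; last by rewrite bnd_simp -ltNge gt_min s0 orbT.
  by rewrite /bdiff /tpow !leNgt s0 (_ : s - d < 0) ?mul0r ?subrr //; lra.
rewrite integral_subX; last by rewrite le_min s0 ltW.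
rewrite /bdiff /tpow s0 subr_ge0 minEle; case: (leP d s) => ds.
  by congr EFin; ring.
by rewrite subrr expr0n /= mul0r; congr EFin; ring.
Qed.

Lemma window_bdiff d f g : window_integral d f g ->
  window_integral d (bdiff d f) (bdiff d g).
Proof.
move=> fg s; have [i1 e1] := fg s; have [i2 e2] := fg (s - d).
have -> : (fun x => (bdiff d f (s - x))%:E) =
    (fun x => (f (s - x))%:E - (f (s - d - x))%:E)%E.
  by apply/funext => x; rewrite /bdiff addrAC EFinB.
split; first exact: integrableB.
by rewrite integralB_EFin // e1 e2 -EFinB.
Qed.

Lemma window_scale d f g a : window_integral d f g ->
  window_integral d (fun s => f s * a) (fun s => g s * a).
Proof.
move=> fg s; have [i e] := fg s.
have -> : (fun x => (f (s - x) * a)%:E) = (fun x => a%:E * (f (s - x))%:E)%E.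
  by apply/funext => x; rewrite mulrC EFinM.
split; first exact: integrableZl.
by rewrite integralZl // e -EFinM /bdiff; congr EFin; ring.
Qed.

Lemma window_iter d f g k : window_integral d f g ->
  window_integral d (iter k (bdiff d) f) (iter k (bdiff d) g).
Proof. by move=> fg; elim: k => //= k; exact: window_bdiff. Qed.

Lemma iter_bdiff_scale d f a k s :
  iter k (bdiff d) (fun s => f s * a) s = iter k (bdiff d) f s * a.
Proof. by elim: k s => //= k IH s; rewrite /bdiff !IH mulrBl. Qed.

Definition box_slice d m s : set (m.-tuple Rm) :=
  [set t : m.-tuple Rm | (forall i, 0 <= tnth t i <= d) /\ \sum_i tnth t i <= s].

Lemma measurable_tuple_sum m : measurable_fun setT (fun t : m.-tuple Rm => \sum_i tnth t i : Rm).
Proof.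
apply: (@measurable_sum _ (m.-tuple Rm) R setT _ _ (fun i t => tnth t i)) => i.
exact: measurable_tnth.
Qed.

Lemma measurable_box d m :
  measurable [set t : m.-tuple Rm | forall i, 0 <= tnth t i <= d].
Proof.
have -> : [set t : m.-tuple Rm | forall i, 0 <= tnth t i <= d] =
    [set t : m.-tuple Rm | forall i, `[0, d]%classic (tnth t i)].
  by apply/seteqP; split => t /= h i; have := h i; rewrite in_itv.
exact: (@measurable_tuple_box R m (fun=> `[0, d]%classic)).
Qed.

Lemma measurable_sum_ray m (I : interval R) :
  measurable [set t : m.-tuple Rm | \sum_i tnth t i \in I].
Proof.
rewrite -[X in measurable X]setTI.
exact: (@measurable_tuple_sum m measurableT [set` I]).
Qed.

Lemma measurable_box_slice d m s : measurable (@box_slice d m s).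
Proof.
apply: measurableI; first exact: measurable_box.
by have := @measurable_sum_ray m `]-oo, s].
Qed.

Lemma box_slice_cons d m s x (t : m.-tuple Rm) :
  box_slice d s (tuple_push (t, x)) <-> 0 <= x <= d /\ box_slice d (s - x) t.
Proof.
rewrite /box_slice /= big_ord_recl /= lerBrDl.
under eq_bigr do rewrite tnthS.
split=> [[h hs]|[h0 [h hs]]].
  split; first exact: (h ord0).
  by split=> // i; have := h (lift ord0 i); rewrite tnthS.
by split=> // i; case: (unliftP ord0 i) => [j|] ->; rewrite ?tnthS.
Qed.

(** Slicing at a coordinate [x] leaves the slice for [s - x], so the formula for [m.+1] is a window
    integral of that for [m]; the divisors in [window_tpow] build up the factorial. *)
Lemma volume_box_slice d m s : 0 < d ->
  lebesgue_tuple m (@box_slice d m s) = (iter m (bdiff d) (tpow m) s / m`!%:R)%:E.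
Proof.
move=> d0; elim: m s => [|m IH] s.
  rewrite /= diracE /tpow expr0 fact0 divr1.
  case: ifPn => s0; [rewrite mem_set //|rewrite memNset //].
    by split=> [[]|]; rewrite ?big_ord0.
  by move=> [_]; rewrite big_ord0; exact/negP.
rewrite lebesgue_tupleS; last exact: measurable_box_slice.
pose F s := iter m (bdiff d) (tpow m) s / m`!%:R.
transitivity (\int[mu]_(x in `[0%R, d]) (F (s - x)%R)%:E)%E.
  rewrite [RHS]integral_mkcond; apply: eq_integral => x _; rewrite patchE mem_setE in_itv /=.
  case: ifPn => xd.
    rewrite -IH; congr (lebesgue_tuple m _); apply/seteqP; split=> t /=.
      by move/box_slice_cons => -[].
    by move=> ht; apply/box_slice_cons.
  rewrite (_ : [set _ | _] = set0) ?measure0 //.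
  by apply/seteqP; split=> // t /box_slice_cons[h]; rewrite h in xd.
have := window_scale m`!%:R^-1 (window_iter m (window_tpow m d0)).
move=> /(_ s)[_ ->]; congr EFin.
rewrite /= /bdiff !iter_bdiff_scale factS natrM -mulrBl -mulrBl invfM; ring.
Qed.

End TruncatedPowers.

(** * Normalized volume of the slab and its agreement with the count *)

Section NormalizedVolume.
Context {R : realType}.
Local Notation Rm := (measurableTypeR R).
Local Notation mu := (@lebesgue_measure R).

Lemma iter_bdiff_neg (d : R) m k s : 0 < d -> s < 0 -> iter k (bdiff d) (tpow m) s = 0.
Proof.
move=> d0; elim: k s => [|k IH] s s0 /=; first by rewrite /tpow leNgt s0.
by rewrite /bdiff !IH ?subr0 //; lra.
Qed.

(** All shifted arguments are negative, where truncated powers and their differences vanish. *)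
Lemma iter_bdiff_small (d : R) m k s : 0 < d -> s < d ->
  iter k (bdiff d) (tpow m) s = tpow m s.
Proof.
move=> d0 sd; elim: k => //= k IH.
by rewrite /bdiff IH iter_bdiff_neg ?subr0 //; lra.
Qed.

Lemma sum_tuple_push m (t : m.-tuple Rm) (x : Rm) :
  \sum_i tnth (tuple_push (t, x)) i = x + \sum_i tnth t i :> R.
Proof. by rewrite big_ord_recl /=; congr (_ + _); apply: eq_bigr => i _; rewrite tnthS. Qed.

(** Sections along the pushed coordinate are single points. In dimension 0 the set is empty when [s]
    is nonzero. *)
Lemma lebesgue_tuple_slab m s : (0 < m)%N || (s != 0) ->
  lebesgue_tuple m [set t : m.-tuple Rm | \sum_i tnth t i = s] = 0%E.
Proof.
case: m => [/= s0|m _].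
  by rewrite /= diracE memNset //= big_ord0 => /esym/eqP; exact/negP.
rewrite -[LHS]/(\int[lebesgue_tuple m]_t mu (xsection _ t))%E.
apply: integral0_eq => t _; rewrite (_ : xsection _ _ = [set s - \sum_i tnth t i]).
  exact: lebesgue_measure_set1.
apply/seteqP; split => x; rewrite /xsection /= inE /= sum_tuple_push.
  by move<-; rewrite addrK.
by move->; rewrite subrK.
Qed.

Lemma drop_last_hyperplane m (c : R) (J : set R) :
  @drop_last R m.+1 @` [set x : 'rV[R]_m.+1 | \sum_i x 0 i = c /\ forall i, J (x 0 i)] =
  [set t : m.-tuple R | (forall i, J (tnth t i)) /\ J (c - \sum_i tnth t i)].
Proof.
have widenE (i : 'I_m) : widen_ord (leq_pred m.+1) i = widen_ord (leqnSn m) i.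
  exact: val_inj.
apply/seteqP; split => [_ [x [<- xJ] <-]|t [tJ sJ]].
  split=> [i|]; first by rewrite tnth_mktuple.
  rewrite big_ord_recr /= (_ : \sum_i tnth _ i = \sum_(i < m) x 0 (widen_ord (leqnSn m) i)).
    by rewrite addrAC subrr add0r.
  by apply: eq_bigr => i _; rewrite tnth_mktuple widenE.
pose f (j : 'I_m.+1) := if unlift ord_max j is Some i then tnth t i else c - \sum_i tnth t i.
have fw i : f (widen_ord (leqnSn m) i) = tnth t i.
  rewrite /f (_ : widen_ord _ i = lift ord_max i) ?liftK //.
  by apply: val_inj; rewrite /= /bump leqNgt ltn_ord.
have fm : f ord_max = c - \sum_i tnth t i by rewrite /f unlift_none.
exists (\row_j f j).
  split=> [|j]; last by rewrite mxE /f; case: unliftP.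
  rewrite big_ord_recr /= mxE fm (eq_bigr (tnth t)) ?subrKC //.
  by move=> i _; rewrite mxE fw.
by apply: eq_from_tnth => i; rewrite tnth_mktuple mxE widenE fw.
Qed.

(** The projection is the difference of the box slices at [c] and [c - d], together with the face
    where the sum is [c - d]. That face is null, in dimension 0 because [c != d]. *)
Lemma hyperplane_volume_slab m (c d : R) : 0 < d -> (0 < m)%N || (c != d) ->
  hyperplane_volume [set x : 'rV[R]_m.+1 | \sum_i x 0 i = c /\ forall i, 0 <= x 0 i <= d] =
  (iter m.+1 (bdiff d) (tpow m) c / m`!%:R)%:E.
Proof.
move=> d0 mc; rewrite /hyperplane_volume.
have fin s : (lebesgue_tuple m (@box_slice R d m s) < +oo)%E by rewrite volume_box_slice // ltry.
have mb := @measurable_box_slice R d m.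
have mS : measurable [set t : m.-tuple Rm | \sum_i tnth t i = c - d].
  have := @measurable_sum_ray R m `[c - d, c - d].
  rewrite (_ : [set _ | _] = [set t : m.-tuple Rm | \sum_i tnth t i = c - d]) //.
  by apply/seteqP; split => t /=; rewrite in_itv /= -eq_le eq_sym => /eqP.
pose S := [set t : m.-tuple Rm | (forall i, 0 <= tnth t i <= d) /\ \sum_i tnth t i = c - d].
have mS' : measurable S by apply: measurableI => //; exact: measurable_box.
have -> : @drop_last R m.+1 @`
    [set x : 'rV[R]_m.+1 | \sum_i x 0 i = c /\ forall i, 0 <= x 0 i <= d] =
    (@box_slice R d m c `\` @box_slice R d m (c - d)) `|` S.
  rewrite (@drop_last_hyperplane m c (fun y => 0 <= y <= d)).
  apply/seteqP; split => t /=; rewrite /box_slice /S /=.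
    move=> [tJ /andP[h1 h2]]; have [h|h] := eqVneq (\sum_i tnth t i) (c - d); [right|left] => //.
    split; first by split=> //; lra.
    by move=> [_ h3]; move/eqP: h; apply; lra.
  by move=> [[[tJ h1] /not_andP[//|/negP]]|[tJ h]]; rewrite -?ltNge => *; split=> //; lra.
transitivity (lebesgue_tuple m ((@box_slice R d m c `\` @box_slice R d m (c - d)) `|` S)) => //.
rewrite measureU0 //; last 2 first.
- exact: measurableD.
- apply: (@subset_measure0 _ _ _ _ _ [set t : m.-tuple Rm | \sum_i tnth t i = c - d]) => //.
    by move=> t [].
  by apply: lebesgue_tuple_slab; rewrite subr_eq0.
have subK : @box_slice R d m c `&` @box_slice R d m (c - d) = @box_slice R d m (c - d).
  by rewrite setIC; apply/setIidPl => t [h1 h2]; split=> //; lra.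
rewrite measureD ?subK; [|exact: mb|exact: mb|exact: fin].
transitivity (lebesgue_tuple m (@box_slice R d m c) -
  lebesgue_tuple m (@box_slice R d m (c - d)%R))%E => //.
by rewrite !volume_box_slice // -EFinB /= /bdiff mulrBl.
Qed.

Lemma hyperplane_volume_std_simplex m :
  hyperplane_volume (@std_simplex R m.+1) = (m`!%:R^-1)%:E.
Proof.
rewrite /hyperplane_volume (@drop_last_hyperplane m 1 (fun y => 0 <= y)).
(* Any side above 1 would do in place of 2: it does not cut the simplex, and [iter_bdiff_small]
   applies at 1. *)
rewrite (_ : [set t | _] = @box_slice R 2 m 1).
  by rewrite volume_box_slice // iter_bdiff_small /tpow ?ler01 ?expr1n ?mul1r ?ltr1n.
apply/seteqP; split => t [tJ h]; (split=> [i|]; last by lra).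
  rewrite tJ /=; have : tnth t i <= \sum_i tnth t i by rewrite (bigD1 i) //= lerDl sumr_ge0.
  by move: h; set S := \sum_i _; lra.
by have /andP[] := tJ i.
Qed.

Lemma normalized_volume_slab m (c d : R) : 0 < d -> (0 < m)%N || (c != d) ->
  normalized_volume [set x : 'rV[R]_m.+1 | \sum_i x 0 i = c /\ forall i, 0 <= x 0 i <= d] =
  (iter m.+1 (bdiff d) (tpow m) c)%:E.
Proof.
move=> d0 mc; rewrite /normalized_volume hyperplane_volume_slab // hyperplane_volume_std_simplex.
have f0 : m`!%:R != 0 :> R by rewrite pnatr_eq0 -lt0n fact_gt0.
by rewrite inver invr_eq0 (negbTE f0) invrK -EFinM divfK.
Qed.

(** Both sides obey the recurrence of [card_short_liftsS]; for [k < d] its missing term matches the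
    vanishing at negative arguments. *)
Lemma card_short_liftsE n K d t k : (0 < d)%N -> (t <= n.+1)%N -> (k <= K)%N ->
  #|short_lifts n K d t k|%:R = iter t (bdiff d%:R) (tpow n) k%:R :> R.
Proof.
move=> d0; elim: t k => [|t IH] k tn kK.
  by rewrite card_short_lifts0 // /= /tpow ler0n natrX.
rewrite /= /bdiff -!IH ?(ltnW tn) //.
rewrite (card_short_liftsS d tn kK) natrD; case: leqP => dk.
  by rewrite -natrB // -IH ?(ltnW tn) ?addrK // (leq_trans (leq_subr _ _)).
rewrite addr0 iter_bdiff_neg ?subr0 ?ltr0n //.
by rewrite subr_lt0 ltr_nat.
Qed.

End NormalizedVolume.

(** * Vertices and dimension of the polytope *)

Section Slab.
Context {R : realType} {n : nat}.
Implicit Types (x y z p : 'rV[R]_n) (i j : 'I_n).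

Definition slab (c d : R) : set 'rV[R]_n :=
  [set x | \sum_i x 0 i = c /\ forall i, 0 <= x 0 i <= d].

Lemma scaled_hypersimplex (c d : R) : 0 < d ->
  [set d *: x | x in @hypersimplex R n (c / d)] = slab c d.
Proof.
move=> d0; have dn0 : d != 0 by rewrite gt_eqF.
apply/seteqP; split => [_ [x [xs x01] <-]|x [xc xd]].
  split=> [|i].
    by under eq_bigr do rewrite mxE; rewrite -mulr_sumr xs mulrC divfK.
  have /andP[x0 x1] := x01 i.
  by rewrite mxE mulr_ge0 ?(ltW d0) //= -[leRHS]mulr1 ler_pM2l.
exists (d^-1 *: x); last by rewrite scalerA divff // scale1r.
split=> [|i].
  by under eq_bigr do rewrite mxE; rewrite -mulr_sumr xc mulrC.
have /andP[x0 x1] := xd i.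
by rewrite mxE mulr_ge0 ?invr_ge0 ?(ltW d0) //= mulrC ler_pdivrMr // mul1r.
Qed.

(** The direction is the kernel of the all-ones column [u]. The point [p] satisfies all bounds
    strictly, so a small multiple of any kernel vector can be added to it within the slab. *)
Lemma slab_has_dim (c d : R) : (0 < n)%N -> 0 < c < n%:R * d ->
  has_dim (slab c d) n.-1.
Proof.
move=> n0 /andP[c0 cd]; have nR : 0 < n%:R :> R by rewrite ltr0n.
pose p : 'rV[R]_n := const_mx (c / n%:R).
pose u : 'cV[R]_n := const_mx 1.
have uE x : x *m u = (\sum_i x 0 i)%:M.
  apply/matrixP => a b; rewrite !ord1 !mxE eqxx mulr1n; apply: eq_bigr => i _.
  by rewrite mxE mulr1.
have sum_p : \sum_i p 0 i = c.
  under eq_bigr do rewrite mxE.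
  by rewrite sumr_const card_ord -(mulr_natr (c / n%:R) n) divfK ?gt_eqF.
have p0 : 0 < c / n%:R by rewrite divr_gt0.
have pd : c / n%:R < d by rewrite ltr_pdivrMr // mulrC.
have sumE x v : \sum_i (x + v) 0 i = \sum_i x 0 i + \sum_i v 0 i.
  by rewrite -big_split; apply: eq_bigr => i _; rewrite mxE.
exists p, (kermx u); split.
- by split=> // i; rewrite mxE !ltW.
- rewrite mxrank_ker -subn1; congr (_ - _)%N; apply/eqP.
  rewrite eqn_leq rank_leq_col lt0n mxrank_eq0; apply/eqP => /matrixP/(_ (Ordinal n0) 0)/eqP.
  by rewrite !mxE oner_eq0.
- move=> x [xc _]; apply/sub_kermxP; rewrite uE (_ : \sum_i _ = 0) ?raddf0 //.
  have := sumE (x - p) p; rewrite subrK xc sum_p => /eqP.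
  by rewrite -subr_eq subrr => /eqP/esym.
move=> W HW; apply/row_subP => a; set r := row a _.
have /sub_kermxP : (r <= kermx u)%MS by exact: row_sub.
rewrite uE => /matrixP/(_ 0 0); rewrite !mxE eqxx mulr1n => r0.
(* [e] is the distance from the coordinates of [p] to the nearer bound; [S] is positive and
   dominates every coordinate of [r]. *)
pose e := Num.min (c / n%:R) (d - c / n%:R).
have e0 : 0 < e by rewrite lt_min p0 subr_gt0.
pose S := 1 + \sum_i `|r 0 i|.
have S0 : 0 < S by rewrite ltr_pwDl // sumr_ge0.
have rS i : `|e / S * r 0 i| <= e.
  rewrite normrM gtr0_norm ?divr_gt0 // mulrAC ler_pdivrMr // ler_pM2l //.
  by rewrite /S (bigD1 i) //= addrCA lerDl addr_ge0 // sumr_ge0.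
have : ((p + (e / S) *: r) - p <= W)%MS.
  apply: HW; split=> [|i].
    rewrite sumE sum_p (eq_bigr (fun i => e / S * r 0 i)); last by move=> i _; rewrite mxE.
    by rewrite -mulr_sumr r0 mulr0 addr0.
  have := rS i; rewrite !mxE ler_norml le_min => /andP[].
  rewrite /e; case: (leP (c / n%:R) (d - c / n%:R)) => h h1 h2; apply/andP; split; lra.
rewrite addrAC subrr add0r => /(scalemx_sub (e / S)^-1).
by rewrite scalerA mulVf ?scale1r // gt_eqF // divr_gt0.
Qed.

End Slab.

(** * The slab as the convex hull of its integer points *)

Section LatticeSlab.
Context {R : realType} {n : nat}.
Implicit Types (x y z p : 'rV[R]_n) (i j : 'I_n) (c d : nat).

Definition convex_rV (H : set 'rV[R]_n) := forall (a : R) y z,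
  0 <= a <= 1 -> H y -> H z -> H (a *: y + (1 - a) *: z).

Definition frac (s : R) : R := s - (Num.floor s)%:~R.

Lemma frac_gt0 s : s \isn't a Num.int -> 0 < frac s.
Proof.
by move=> si; rewrite subr_gt0 lt_neqAle floor_le_tmp andbT -intrEfloor.
Qed.

Lemma frac_lt1 s : frac s < 1.
Proof. by rewrite /frac ltrBlDl; have := floorD1_gt s; rewrite intrD. Qed.

(* Moves mass from coordinate j to coordinate i until one of them becomes an
   integer; x is a convex combination of transfer i j x and transfer j i x. *)
Definition transfer i j x : 'rV[R]_n :=
  x + Num.min (1 - frac (x 0 i)) (frac (x 0 j)) *: (delta_mx 0 i - delta_mx 0 j).

Definition fractional x : pred 'I_n := fun i => x 0 i \isn't a Num.int.

Lemma transferE i j x k : transfer i j x 0 k =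
  x 0 k + Num.min (1 - frac (x 0 i)) (frac (x 0 j)) * ((k == i)%:R - (k == j)%:R).
Proof. by rewrite !mxE !eqxx. Qed.

(** The bounds 0 and [d] are integers, so a coordinate moved no further than the next integer stays
    between them. *)
Lemma transfer_slab i j x c d : i != j -> fractional x i -> fractional x j ->
  slab c%:R d%:R x -> slab c%:R d%:R (transfer i j x).
Proof.
move=> ij xi xj [xc xd]; split.
  under eq_bigr do rewrite transferE.
  rewrite big_split /= xc -mulr_sumr sumrB.
  have sum1 (l : 'I_n) : \sum_k (k == l)%:R = 1 :> R.
    by rewrite (bigD1 l) //= eqxx big1 ?addr0 // => k /negbTE ->.
  by rewrite !sum1 subrr mulr0 addr0.
move=> k; rewrite transferE; set m := Num.min _ _.
have m0 : 0 <= m by rewrite le_min subr_ge0 !ltW ?frac_lt1 ?frac_gt0.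
have [m1 m2] : m <= 1 - frac (x 0 i) /\ m <= frac (x 0 j).
  by rewrite !ge_min !lexx orbT.
have /andP[xk0 xkd] := xd k.
have [ki|ki] := eqVneq k i.
  rewrite ki (negbTE ij) subr0 mulr1; rewrite ki in xk0 xkd.
  rewrite addr_ge0 //=; apply: le_trans (lerD (lexx _) m1) _.
  rewrite (_ : _ + _ = (Num.floor (x 0 i) + 1)%:~R); last by rewrite /frac intrD; ring.
  rewrite -[d%:R]/((Posz d)%:~R) ler_int lezD1 -(ltr_int R).
  by apply: lt_le_trans xkd; rewrite -subr_gt0 frac_gt0 // ki.
have [kj|kj] := eqVneq k j; last by rewrite subrr mulr0 addr0 xk0.
rewrite sub0r mulrN1; rewrite kj in xk0 xkd *; apply/andP; split; last by lra.
rewrite subr_ge0; apply: le_trans m2 _; rewrite /frac gerBl ler0z.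
by rewrite floor_ge0.
Qed.

Lemma transfer_fractional i j x : i != j -> fractional x i -> fractional x j ->
  (#|fractional (transfer i j x)| < #|fractional x|)%N.
Proof.
have fE y k : (k \in fractional y) = (y 0 k \isn't a Num.int) by [].
move=> ij xi xj; apply: proper_card; apply/properP; split.
  apply/fintype.subsetP => k; rewrite !fE transferE; apply: contra => xk.
  have [ki|ki] := eqVneq k i; first by move: xi; rewrite /fractional -ki xk.
  have [kj|kj] := eqVneq k j; first by move: xj; rewrite /fractional -kj xk.
  by rewrite subrr mulr0 addr0.
case: (leP (1 - frac (x 0 i)) (frac (x 0 j))) => h.
  exists i => //; rewrite fE negbK transferE (min_idPl h) eqxx (negbTE ij).
  rewrite subr0 mulr1 (_ : _ + _ = (Num.floor (x 0 i) + 1)%:~R) //.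
  by rewrite /frac intrD; ring.
exists j => //; rewrite fE negbK transferE (min_idPr (ltW h)) eqxx.
rewrite eq_sym (negbTE ij) sub0r mulrN1 /frac (_ : _ - _ = (Num.floor (x 0 j))%:~R) //.
by ring.
Qed.

(** The sum [c] is an integer, so no coordinate can be the only fractional one. *)
Lemma fractional_other c d x i : slab c%:R d%:R x -> fractional x i ->
  exists2 j, i != j & fractional x j.
Proof.
move=> [xc _] xi; apply/exists2P; apply: contrapT => h.
have xint j : j != i -> x 0 j \is a Num.int.
  move=> ji; apply: contrapT => /negP xj; apply: h; exists j; split => //.
  by rewrite eq_sym.
move/negP: xi; apply.
have -> : x 0 i = c%:R - \sum_(j | j != i) x 0 j.
  by rewrite -xc (bigD1 i) //= addrK.
by rewrite rpredB ?rpred_sum // rpred_nat.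
Qed.

(** Induction on the number of fractional coordinates, which the two opposite transfers between a
    pair of them both lower. *)
Lemma slab_convex_hull (H : set 'rV[R]_n) c d : convex_rV H ->
  (forall x, slab c%:R d%:R x -> (forall i, x 0 i \is a Num.int) -> H x) ->
  slab c%:R d%:R `<=` H.
Proof.
move=> cH iH x; have [k] := ubnP #|fractional x|.
elim: k x => // k IH x xk xs.
have [xi|] := pselect (forall i, x 0 i \is a Num.int); first exact: iH.
move=> /existsNP[i /negP xi]; have [j ij xj] := fractional_other xs xi.
have ji : j != i by rewrite eq_sym.
have Hi : H (transfer i j x).
  apply: IH; last exact: transfer_slab.
  by apply: leq_trans (transfer_fractional ij xi xj) _.
have Hj : H (transfer j i x).
  apply: IH; last exact: transfer_slab.
  by apply: leq_trans (transfer_fractional ji xj xi) _.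
pose s := Num.min (1 - frac (x 0 i)) (frac (x 0 j)).
pose t := Num.min (1 - frac (x 0 j)) (frac (x 0 i)).
have s0 : 0 < s by rewrite lt_min subr_gt0 frac_lt1 frac_gt0.
have t0 : 0 < t by rewrite lt_min subr_gt0 frac_lt1 frac_gt0.
have st : s + t != 0 by rewrite gt_eqF // addr_gt0.
(* The displacements are [s] and [t] times opposite vectors; these weights cancel them. *)
have -> : x = (t / (s + t)) *: transfer i j x + (1 - t / (s + t)) *: transfer j i x.
  by apply/rowP => l; rewrite !mxE !eqxx -/s -/t /=; field.
have st0 : 0 < s + t by rewrite addr_gt0.
by apply: cH => //; rewrite divr_ge0 ?(ltW t0) ?(ltW st0) //= ler_pdivrMr // mul1r lerDr ltW.
Qed.

Lemma slab_lattice c d : lattice_polytope (@slab R n c%:R d%:R).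
Proof.
(* The generators are all the integer points of the slab. *)
pose A : pred {ffun 'I_n -> 'I_d.+1} := fun f => (\sum_i f i == c)%N.
pose e (a : 'I_#|A|) : {ffun 'I_n -> 'I_d.+1} := enum_val a.
pose V : 'M[int]_(#|A|, n) := \matrix_(a, i) Posz (e a i).
exists #|A|, V.
have VE a i : map_mx intr V a i = (e a i)%:R :> R by rewrite !mxE.
apply/seteqP; split; last first.
  move=> _ [w [w1 w0] <-].
  have wE i : (w *m map_mx intr V) 0 i = \sum_a w 0 a * (e a i)%:R.
    by rewrite mxE; apply: eq_bigr => a _; rewrite VE.
  split.
    under eq_bigr do rewrite wE.
    rewrite exchange_big /= (eq_bigr (fun a => w 0 a * c%:R)); last first.
      move=> a _; rewrite -mulr_sumr -natr_sum; congr (_ * _%:R).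
      by have := enum_valP a; rewrite unfold_in => /eqP.
    by rewrite -mulr_suml w1 mul1r.
  move=> i; rewrite wE sumr_ge0 => [|a _]; last by rewrite mulr_ge0.
  have -> : d%:R = \sum_a w 0 a * d%:R by rewrite -mulr_suml w1 mul1r.
  by apply: ler_sum => a _; apply: ler_wpM2l => //; rewrite ler_nat -ltnS ltn_ord.
apply: slab_convex_hull.
  move=> a _ _ /andP[a0 a1] [v [v1 v0] <-] [w [w1 w0] <-].
  exists (a *: v + (1 - a) *: w); last by rewrite mulmxDl !scalemxAl.
  split=> [|j]; last by rewrite !mxE addr_ge0 // mulr_ge0 // subr_ge0.
  under eq_bigr do rewrite !mxE.
  by rewrite big_split /= -!mulr_sumr v1 w1 !mulr1 subrKC.
move=> x [xc xd] xi.
have /choice[f fx] : forall i, exists k : 'I_d.+1, x 0 i = k%:R.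
  move=> i; have /andP[x0 xd'] := xd i.
  have /natrP[k xk] : x 0 i \is a Num.nat by rewrite natrEint xi x0.
  have kd : (k < d.+1)%N by rewrite ltnS -(ler_nat R) -xk.
  by exists (Ordinal kd).
pose g : {ffun 'I_n -> 'I_d.+1} := [ffun i => f i].
have gA : g \in A.
  rewrite unfold_in /A -(eqr_nat R) natr_sum -xc; apply/eqP.
  by apply: eq_bigr => i _; rewrite fx ffunE.
exists (delta_mx 0 (enum_rank_in gA g)).
  split=> [|j]; last by rewrite mxE.
  rewrite (bigD1 (enum_rank_in gA g)) //= big1 => [|j /negbTE h]; rewrite mxE ?eqxx ?addr0 //.
  by rewrite h.
rewrite -rowE; apply/rowP => i.
by rewrite mxE VE /e enum_rankK_in // fx ffunE.
Qed.

End LatticeSlab.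

Theorem theorem4p3 (R : realType) (n c d : nat) (n_gt0 : (0 < n)%N)
    (c_gt0 : (0 < c)%N) (d_gt0 : (0 < d)%N) (cop_cd : gcdn c d = 1%N)
    (cd_bound : 0 < (c%:R / d%:R : R) < n%:R) :
  let P : set 'rV[R]_n :=
    [set d%:R *: x | x in @hypersimplex R n (c%:R / d%:R)] in
  [/\ P = [set x : 'rV[R]_n | \sum_i x 0 i = c%:R /\ forall i, 0 <= x 0 i <= d%:R],
      lattice_polytope P,
      has_dim P n.-1
    & normalized_volume P = ((refined_eulerian (d * n).-1 c.-1 d)%:R)%:E].
Proof.
move=> P; have dR : 0 < d%:R :> R by rewrite ltr0n.
have c_lt : (c < n * d)%N.
  by case/andP: cd_bound => _; rewrite ltr_pdivrMr // -natrM ltr_nat.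
have -> : P = slab c%:R d%:R by exact: scaled_hypersimplex.
split=> //; first exact: slab_lattice.
  by apply: slab_has_dim; rewrite // ltr0n c_gt0 -natrM ltr_nat.
case: n n_gt0 cd_bound @P c_lt => // m _ _ _ c_lt.
have MnE : (d * m.+1).-1.+1 = (d * m.+1)%N by rewrite prednK // muln_gt0 d_gt0.
rewrite normalized_volume_slab //; last first.
  (* In dimension 0 the bound on [c / d] reads [c < d], whence [c != d]. *)
  case: m c_lt MnE => //= + _; rewrite mul1n => cd.
  by rewrite eqr_nat neq_ltn cd.
have MdE : ((d * m.+1).-1.+1 %/ d = m.+1)%N by rewrite MnE mulKn.
rewrite refined_eulerianE (prednK c_gt0) MdE.
(* The bound [K] on the quotients is taken to be [c]. *)
rewrite (@card_rooted_words _ m c d c MnE) //; last by rewrite /coprime cop_cd.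
by rewrite (@card_short_liftsE R).
Qed.
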